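(* Consider the constrained joint dynamics $$\frac{dy}{dt}=-\alpha\,P_{\mathcal{Q}}\bigl(\delta^T\delta\,x\bigr),\qquad \frac{d\delta}{dt}=-\beta\,\Pi_{\mathcal{M}}\bigl(\delta\,x\,x^T\bigr),\qquad x=\tilde u+\tilde y,\quad \alpha,\beta>0,$$ with initial condition $(y_0,\delta_0)$, and put $x_0=\tilde u+\tilde y_0$. Assume that on $[0,T]$: 1. $\sup_{t\in[0,T]}\|x(t)\|\le B_x$ for some $B_x>0$; 2. the effective spectral gap $$\lambda_{\mathrm{eff}}:=\inf_{t\in[0,T]}\frac{\|P_{\mathcal{Q}}(L_{\mathcal{F}}(\delta(t))x(t))\|^2}{\|\delta(t)x(t)\|^2}$$ is positive. Then $$\|\delta(T)-\delta_0\|_F\le\frac{\beta B_x\|\delta_0x_0\|}{\alpha\lambda_{\mathrm{eff}}}\bigl(1-e^{-\alpha\lambda_{\mathrm{eff}}T}\bigr)\le\frac{\beta B_x\|\delta_0x_0\|}{\alpha\lambda_{\mathrm{eff}}}.$$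
   Context: Let $G=(V,E)$ be a finite connected graph. A discourse sheaf $\mathcal{F}$ on $G$ assigns finite-dimensional real inner product spaces $\mathcal{F}(v)$, $\mathcal{F}(e)$ to vertices and edges and linear restriction maps $\mathcal{F}_{v\unlhd e}:\mathcal{F}(v)\to\mathcal{F}(e)$ to incidences $v\in e$ (written $v\unlhd e$). $C^0=\bigoplus_v\mathcal{F}(v)$, $C^1=\bigoplus_e\mathcal{F}(e)$ with direct-sum inner products. For a fixed edge orientation the coboundary is $(\delta x)_e=\mathcal{F}_{v\unlhd e}(x_v)-\mathcal{F}_{u\unlhd e}(x_u)$ for $e=u\to v$. In the joint dynamics the stalks are fixed, but the restriction maps, encoded by the blocks of $\delta$ (the block from $\mathcal{F}(v)$ to $\mathcal{F}(e)$ is $\pm\mathcal{F}_{v\unlhd e}$, and blocks for non-incident pairs are zero), vary with time. $L_{\mathcal{F}}(\delta)=\delta^T\delta$, and $\|\cdot\|_F$ is the Frobenius norm. Stubborn opinions: $U\subseteq V$ is the set of stubborn vertices; each stalk splits orthogonally as $\mathcal{F}(v)=S_v\oplus T_v$ with $T_v=S_v^\perp$ and $S_v=\{0\}$ for $v\notin U$. $C^0(S)=\bigoplus_vS_v$, $C^0(\mathcal{Q})=\bigoplus_vT_v$; $P_{\mathcal{Q}}:C^0\to C^0(\mathcal{Q})$ is the orthogonal projection. $u\in C^0(S)$ is fixed (constant in time), $y(t)\in C^0(\mathcal{Q})$ evolves, and $\tilde u,\tilde y$ denote their inclusions in $C^0$. Adapting incidences: $\mathcal{I}\subseteq\{(v,e):v\unlhd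 e\}$. $\mathcal{M}$ is the space of linear maps $C^0\to C^1$ whose block from $\mathcal{F}(v)$ to $\mathcal{F}(e)$ vanishes unless $(v,e)\in\mathcal{I}$; $\Pi_{\mathcal{M}}$ is the orthogonal projection onto $\mathcal{M}$ in the Frobenius inner product. $\delta xx^T$ denotes the map $z\mapsto\langle x,z\rangle\,\delta x$. Convention: positivity of $\lambda_{\mathrm{eff}}$ means that the ratio is bounded away from zero over those $t\in[0,T]$ with $\delta(t)x(t)\ne0$ (the infimum is over such $t$). If $\delta(t)x(t)=0$ at some time, the system is at equilibrium and the bound is understood to hold with zero displacement. *)

(* Defs.v *)
From HB Require Import structures.
From mathcomp Require Import all_boot all_order all_algebra.
From mathcomp Require Import all_classical all_reals all_analysis.

Set Implicit Arguments.
Unset Strict Implicit.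
Unset Printing Implicit Defensive.
Import Order.TTheory GRing.Theory Num.Theory.
Import numFieldNormedType.Exports.

Local Open Scope ring_scope.

HB.mixin Record Vector_isInner (R : realType) U of Vector R U := {
  dotp : {dot U for (@idfun R)}
}.

#[short(type="innerType")]
HB.structure Definition Inner (R : realType) :=
  {U of Vector_isInner R U & Vector R U}.

Definition inner (R : realType) (U : innerType R) (u v : U) : R := dotp u v.

Definition inorm (R : realType) (U : innerType R) (u : U) : R :=
  Num.sqrt (inner u u).

Section InnerTheory.
Variables (R : realType) (U : innerType R).
Implicit Types (u v w : U) (a : R).

Lemma innerC u v : inner u v = inner v u.
Proof. by rewrite /inner hermC /= expr0 mul1r. Qed.

Lemma innerDl u v w : inner (u + v) w = inner u w + inner v w.
Proof. exact: linearDl. Qed.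

Lemma innerZl a u w : inner (a *: u) w = a * inner u w.
Proof. exact: linearZl_LR. Qed.

Lemma innerDr u v w : inner w (u + v) = inner w u + inner w v.
Proof. by rewrite innerC innerDl !(innerC w). Qed.

Lemma innerZr a u w : inner w (a *: u) = a * inner w u.
Proof. by rewrite innerC innerZl (innerC w). Qed.

Lemma inner_gt0 u : u != 0 -> 0 < inner u u.
Proof. exact: neq0_dnorm_gt0. Qed.

Lemma inner0l w : inner 0 w = 0.
Proof. by rewrite -(scale0r 0) innerZl mul0r. Qed.

Lemma inner0r w : inner w 0 = 0.
Proof. by rewrite innerC inner0l. Qed.

Lemma inner_eq0 u : inner u u = 0 -> u = 0.
Proof.
by move=> u0; apply/eqP; apply: contraT => /inner_gt0; rewrite u0 ltxx.
Qed.

Lemma inner_suml (I : Type) (r : seq I) (P : pred I) (F : I -> U) w :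
  inner (\sum_(i <- r | P i) F i) w = \sum_(i <- r | P i) inner (F i) w.
Proof.
elim/big_rec2: _ => [|i a b _ <-]; first exact: inner0l.
by rewrite innerDl.
Qed.

Lemma inner_sumr (I : Type) (r : seq I) (P : pred I) (F : I -> U) w :
  inner w (\sum_(i <- r | P i) F i) = \sum_(i <- r | P i) inner w (F i).
Proof. by rewrite innerC inner_suml; apply: eq_bigr => i _; rewrite innerC. Qed.

Definition orthonormal_tuple n (X : n.-tuple U) :=
  forall i j : 'I_n, inner X`_i X`_j = (i == j)%:R.

Lemma orthonormal_tuple_free n (X : n.-tuple U) : orthonormal_tuple X -> free X.
Proof.
move=> oX; apply/freeP => k k0 i.
have : inner X`_i (\sum_(j < n) k j *: X`_j) = 0 by rewrite k0 inner0r.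
rewrite inner_sumr (bigD1 i) //= big1 => [|j ji].
  by rewrite addr0 innerZr oX eqxx mulr1.
by rewrite innerZr oX eq_sym (negPf ji) mulr0.
Qed.

Lemma orthonormal_exists n (W : {vspace U}) : \dim W = n ->
  exists X : n.-tuple U, basis_of W X /\ orthonormal_tuple X.
Proof.
elim: n W => [|n IH] W dW.
  exists [tuple]; split; last by case.
  by move/eqP: dW; rewrite dimv_eq0 => /eqP ->; rewrite basisEdim span_nil sub0v dimv0.
have v0 : vpick W != 0 by rewrite vpick0 -dimv_eq0 dW.
have vW := memv_pick W.
set v := vpick W in v0 vW.
pose e := (inorm v)^-1 *: v.
have v_gt0 := inner_gt0 v0.
have eW : e \in W by rewrite memvZ.
have ee : inner e e = 1.
  rewrite innerZl innerZr mulrA -expr2 exprVn sqr_sqrtr ?ltW //.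
  by rewrite mulVf ?gt_eqF.
have eN : e \notin orthov (dotp : {dot U for idfun}) W.
  apply/mem_orthovPn; exists e => //; change (inner e e != 0).
  by rewrite ee oner_eq0.
have dW' := eq_dim_orthov1 eN; rewrite dW /= in dW'.
have [X [/andP[/eqP sX fX] oX]] := IH _ (esym dW').
have Xe (i : 'I_n) : inner X`_i e = 0.
  have : X`_i \in <<X>>%VS by rewrite memv_span // mem_nth // size_tuple.
  by rewrite sX memv_cap => /andP[_]; rewrite mem_orthov1 => /eqP.
have oeX : orthonormal_tuple [tuple of e :: X].
  move=> i j; case: (unliftP ord0 i) => [i'|] ->; case: (unliftP ord0 j) => [j'|] -> /=.
  - by rewrite oX (inj_eq lift_inj).
  - by rewrite Xe.
  - by rewrite innerC Xe.
  - by rewrite ee.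
exists [tuple of e :: X]; split=> //.
rewrite basisEfree (orthonormal_tuple_free oeX) /= size_tuple dW leqnn andbT.
rewrite span_cons subv_add -memvE eW /= sX; exact: capvSl.
Qed.

Definition onb : (\dim {:U}).-tuple U :=
  projT1 (cid (orthonormal_exists (erefl (\dim {:U})))).

Lemma onb_basis : basis_of {:U} onb.
Proof. by rewrite /onb; case: cid => X /= []. Qed.

Lemma onb_orthonormal : orthonormal_tuple onb.
Proof. by rewrite /onb; case: cid => X /= []. Qed.

Lemma onbE u : u = \sum_(i < \dim {:U}) inner onb`_i u *: onb`_i.
Proof.
rewrite {1}(coord_basis onb_basis (memvf u)); apply: eq_bigr => i _.
congr (_ *: _); rewrite {2}(coord_basis onb_basis (memvf u)) inner_sumr.
rewrite (bigD1 i) //= big1 ?addr0 => [|j ji].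
  by rewrite innerZr onb_orthonormal eqxx mulr1.
by rewrite innerZr onb_orthonormal eq_sym (negPf ji) mulr0.
Qed.

Definition orthoc (W : {vspace U}) : {vspace U} :=
  orthov (dotp : {dot U for idfun}) W.

Lemma mem_orthoc (W : {vspace U}) u :
  reflect (forall w, w \in W -> inner u w = 0) (u \in orthoc W).
Proof. exact: mem_orthovP. Qed.

Lemma capv_orthoc (W : {vspace U}) : (W :&: orthoc W = 0)%VS.
Proof.
apply/eqP; rewrite -subv0; apply/subvP => w; rewrite memv_cap memv0.
by case/andP=> wW /mem_orthoc/(_ _ wW)/inner_eq0 ->.
Qed.

Lemma addv_orthoc (W : {vspace U}) : (W + orthoc W = {:U})%VS.
Proof.
have [X [bX oX]] := orthonormal_exists (erefl (\dim W)).
apply/vspaceP => u; rewrite memvf; apply/idP.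
pose p := \sum_(i < \dim W) inner X`_i u *: X`_i.
have XW (i : 'I_(\dim W)) : X`_i \in W.
  by apply: (basis_mem bX); rewrite mem_nth ?size_tuple.
have pW : p \in W by apply: memv_suml => i _; rewrite memvZ.
rewrite -(subrK p u) addrC memv_add //; apply/mem_orthoc => w.
move/(coord_basis bX) ->; rewrite inner_sumr big1 // => i _.
rewrite innerZr innerDl -scaleN1r innerZl inner_suml (bigD1 i) //= big1.
  by rewrite addr0 innerZl oX eqxx mulr1 mulN1r innerC subrr mulr0.
by move=> j ji; rewrite innerZl oX (negPf ji) mulr0.
Qed.

(* [daddv_pi V W] is the projection onto V along W. *)
Definition oproj (W : {vspace U}) : 'End(U) := daddv_pi W (orthoc W).

Lemma oproj_mem (W : {vspace U}) u : oproj W u \in W.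
Proof. exact: memv_pi. Qed.

Lemma oproj_orthoc (W : {vspace U}) u : u - oproj W u \in orthoc W.
Proof.
rewrite -{1}(@daddv_pi_add _ _ W (orthoc W) u) ?capv_orthoc ?addv_orthoc ?memvf //.
by rewrite addrAC subrr add0r memv_pi.
Qed.

End InnerTheory.

Section LinearMaps.
Variables (R : realType) (U W : innerType R).

(* Basis independent: see [adjointP]. *)
Definition adjoint_fun (f : 'Hom(U, W)) (w : W) : U :=
  \sum_(i < \dim {:U}) inner (f (onb U)`_i) w *: (onb U)`_i.

Fact adjoint_fun_linear f : linear (adjoint_fun f).
Proof.
move=> a v w; rewrite /adjoint_fun scaler_sumr -big_split /=.
by apply: eq_bigr => i _; rewrite innerDr innerZr scalerDl scalerA.
Qed.

HB.instance Definition _ f :=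
  GRing.isLinear.Build R W U _ (adjoint_fun f) (adjoint_fun_linear f).

Definition adjoint (f : 'Hom(U, W)) : 'Hom(W, U) := linfun (adjoint_fun f).

Lemma adjointP (f : 'Hom(U, W)) u w : inner (f u) w = inner u (adjoint f w).
Proof.
rewrite lfunE /= /adjoint_fun inner_sumr {1}(onbE u) linear_sum inner_suml.
by apply: eq_bigr => i _; rewrite linearZ innerZl innerZr mulrC innerC (innerC u).
Qed.

Definition laplacian (delta : 'Hom(U, W)) : 'End(U) :=
  (adjoint delta \o delta)%VF.

Definition outer_fun (x : U) (w : W) (z : U) : W := inner x z *: w.

Fact outer_fun_linear x w : linear (outer_fun x w).
Proof. by move=> a u v; rewrite /outer_fun innerDr innerZr scalerDl scalerA. Qed.

HB.instance Definition _ x w :=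
  GRing.isLinear.Build R U W _ (outer_fun x w) (outer_fun_linear x w).

(* the map w x^T *)
Definition outer (w : W) (x : U) : 'Hom(U, W) := linfun (outer_fun x w).

(* tr (f^T g), computed in an orthonormal basis of U. *)
Definition frob (f g : 'Hom(U, W)) : R :=
  \sum_(i < \dim {:U}) inner (f (onb U)`_i) (g (onb U)`_i).

Fact frob_bilinear : bilinear_for
  (GRing.Scale.Law.clone _ _ ( *%R ) _)
  (GRing.Scale.Law.clone _ _ (@idfun R \; *%R ) _) frob.
Proof.
split=> [g|f] a h k /=; rewrite /frob mulr_sumr -big_split /=;
  apply: eq_bigr => i _; rewrite add_lfunE scale_lfunE.
- by rewrite innerDl innerZl.
- by rewrite innerDr innerZr.
Qed.

HB.instance Definition _ := bilinear_isBilinear.Build R _ _ _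
  (GRing.Scale.Law.clone _ _ ( *%R ) _)
  (GRing.Scale.Law.clone _ _ (@idfun R \; *%R ) _) frob frob_bilinear.

Fact frob_sym f g : frob f g = (-1) ^+ false * idfun (frob g f).
Proof.
by rewrite expr0 mul1r /frob; apply: eq_bigr => i _; rewrite innerC.
Qed.

HB.instance Definition _ :=
  @isHermitianSesquilinear.Build R 'Hom(U, W) false idfun frob frob_sym.

Lemma inner_ge0 (V : innerType R) (v : V) : 0 <= inner v v.
Proof. by case: (eqVneq v 0) => [->|/inner_gt0/ltW //]; rewrite inner0l. Qed.

Fact frob_gt0 f : f != 0 -> 0 < frob f f.
Proof.
move=> f0; rewrite lt_def sumr_ge0 ?andbT => [|i _]; last exact: inner_ge0.
apply: contra f0 => /eqP/psumr_eq0P fi0; apply/eqP/lfunP => u.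
rewrite lfunE /= (onbE u) linear_sum big1 // => i _.
by rewrite linearZ /= (inner_eq0 (fi0 _ i isT)) ?scaler0 // => j _; exact: inner_ge0.
Qed.

HB.instance Definition _ :=
  @isDotProduct.Build R 'Hom(U, W) frob frob_gt0.

(* The norm of ['Hom(U, W)] is hence the Frobenius norm. *)
HB.instance Definition _ := Vector_isInner.Build R 'Hom(U, W) frob.

End LinearMaps.

Definition dsum (R : realType) (I : finType) (F : I -> innerType R) : Type :=
  {dffun forall i, F i}.

Section DirectSum.
Variables (R : realType) (I : finType) (F : I -> innerType R).
Local Notation D := (dsum F).
Implicit Types (f g h : D).

HB.instance Definition _ := Choice.on D.

Definition dsum_zero : D := [ffun i => 0 : F i].
Definition dsum_opp f : D := [ffun i => - f i : F i].
Definition dsum_add f g : D := [ffun i => f i + g i : F i].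
Definition dsum_scale (a : R) f : D := [ffun i => a *: f i : F i].

Fact dsum_addA : associative dsum_add.
Proof. by move=> f g h; apply/ffunP => i; rewrite !ffunE addrA. Qed.
Fact dsum_addC : commutative dsum_add.
Proof. by move=> f g; apply/ffunP => i; rewrite !ffunE addrC. Qed.
Fact dsum_add0 : left_id dsum_zero dsum_add.
Proof. by move=> f; apply/ffunP => i; rewrite !ffunE add0r. Qed.
Fact dsum_addN : left_inverse dsum_zero dsum_opp dsum_add.
Proof. by move=> f; apply/ffunP => i; rewrite !ffunE addNr. Qed.

HB.instance Definition _ :=
  GRing.isZmodule.Build D dsum_addA dsum_addC dsum_add0 dsum_addN.

Fact dsum_scaleA a b f : dsum_scale a (dsum_scale b f) = dsum_scale (a * b) f.
Proof. by apply/ffunP => i; rewrite !ffunE scalerA. Qed.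
Fact dsum_scale1 : left_id 1 dsum_scale.
Proof. by move=> f; apply/ffunP => i; rewrite !ffunE scale1r. Qed.
Fact dsum_scaleDr : right_distributive dsum_scale +%R.
Proof. by move=> a f g; apply/ffunP => i; rewrite !ffunE scalerDr. Qed.
Fact dsum_scaleDl f : {morph dsum_scale^~ f : a b / a + b}.
Proof. by move=> a b; apply/ffunP => i; rewrite !ffunE scalerDl. Qed.

HB.instance Definition _ := GRing.Zmodule_isLmodule.Build R D
  dsum_scaleA dsum_scale1 dsum_scaleDr dsum_scaleDl.

Lemma dsumDE f g i : (f + g) i = f i + g i. Proof. exact: ffunE. Qed.
Lemma dsumZE a f i : (a *: f) i = a *: f i. Proof. exact: ffunE. Qed.
Lemma dsum0E i : (0 : D) i = 0. Proof. exact: ffunE. Qed.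

Import VectorInternalTheory.
Local Notation K := {i : I & 'I_(dim (F i))}.

Fact dsum_vect_axiom : Vector.axiom #|{: K}| D.
Proof.
pose to (f : D) : 'rV[R]_#|{: K}| :=
  \row_k v2r (f (tag (enum_val k))) 0 (tagged (enum_val k)).
exists to.
  by move=> a f g; apply/rowP => k; rewrite !mxE dsumDE dsumZE linearP !mxE.
exists (fun r : 'rV[R]_#|{: K}| => [ffun i => r2v
  (\row_j r 0 (enum_rank (Tagged (fun i => 'I_(dim (F i))) j))) : F i] : D).
  move=> f; apply/ffunP => i; rewrite ffunE -[RHS]v2rK.
  by congr r2v; apply/rowP => j; rewrite !mxE enum_rankK.
move=> r; apply/rowP => k; rewrite !mxE ffunE r2vK mxE.
by congr (r _ _); rewrite -[RHS]enum_valK; congr enum_rank; case: (enum_val k).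
Qed.

HB.instance Definition _ := Lmodule_hasFinDim.Build R D dsum_vect_axiom.

Definition dsum_dot f g : R := \sum_i inner (f i) (g i).

Fact dsum_dot_bilinear : bilinear_for
  (GRing.Scale.Law.clone _ _ ( *%R ) _)
  (GRing.Scale.Law.clone _ _ (@idfun R \; *%R ) _) dsum_dot.
Proof.
split=> [g|f] a h k /=; rewrite /dsum_dot mulr_sumr -big_split /=;
  apply: eq_bigr => i _; rewrite dsumDE dsumZE.
- by rewrite innerDl innerZl.
- by rewrite innerDr innerZr.
Qed.

HB.instance Definition _ := bilinear_isBilinear.Build R _ _ _
  (GRing.Scale.Law.clone _ _ ( *%R ) _)
  (GRing.Scale.Law.clone _ _ (@idfun R \; *%R ) _) dsum_dot dsum_dot_bilinear.

Fact dsum_dot_sym f g : dsum_dot f g = (-1) ^+ false * idfun (dsum_dot g f).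
Proof.
by rewrite expr0 mul1r /dsum_dot; apply: eq_bigr => i _; rewrite innerC.
Qed.

HB.instance Definition _ :=
  @isHermitianSesquilinear.Build R D false idfun dsum_dot dsum_dot_sym.

Fact dsum_dot_gt0 f : f != 0 -> 0 < dsum_dot f f.
Proof.
move=> f0; rewrite lt_def sumr_ge0 ?andbT => [|i _]; last exact: inner_ge0.
apply: contra f0 => /eqP/psumr_eq0P fi0; apply/eqP/ffunP => i.
by rewrite ffunE (inner_eq0 (fi0 _ i isT)) // => j _; exact: inner_ge0.
Qed.

HB.instance Definition _ := @isDotProduct.Build R D dsum_dot dsum_dot_gt0.

HB.instance Definition _ := Vector_isInner.Build R D dsum_dot.

Lemma inner_dsumE f g : inner f g = \sum_i inner (f i) (g i).
Proof. by []. Qed.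

Definition dproj_fun i (f : D) : F i := f i.

Fact dproj_fun_linear i : linear (@dproj_fun i).
Proof. by move=> a f g; rewrite /dproj_fun dsumDE dsumZE. Qed.

HB.instance Definition _ i :=
  GRing.isLinear.Build R D (F i) _ (@dproj_fun i) (@dproj_fun_linear i).

Definition dproj i : 'Hom(D, F i) := linfun (@dproj_fun i).

Lemma dprojE i f : dproj i f = f i. Proof. by rewrite lfunE. Qed.

Definition dinj_fun i (a : F i) : D :=
  [ffun j => eqtype.dfwith (fun k => 0 : F k) a j].

Fact dinj_fun_linear i : linear (@dinj_fun i).
Proof.
move=> c a b; apply/ffunP => j; rewrite dsumDE dsumZE !ffunE.
have [<-|ij] := eqVneq i j; first by rewrite !dfwith_in.
by rewrite !dfwith_out // scaler0 addr0.
Qed.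

HB.instance Definition _ i :=
  GRing.isLinear.Build R (F i) D _ (@dinj_fun i) (@dinj_fun_linear i).

Definition dinj i : 'Hom(F i, D) := linfun (@dinj_fun i).

Lemma dinj_in i (a : F i) : dinj i a i = a.
Proof. by rewrite lfunE /= ffunE dfwith_in. Qed.

Lemma dinj_out i j (a : F i) : i != j -> dinj i a j = 0.
Proof. by move=> ij; rewrite lfunE /= ffunE dfwith_out. Qed.

Lemma dsum_dinj f : f = \sum_i dinj i (f i).
Proof.
apply/ffunP => j; rewrite -[RHS]dprojE linear_sum (bigD1 j) //= big1.
  by rewrite addr0 dprojE dinj_in.
by move=> i ij; rewrite dprojE dinj_out.
Qed.

Definition dsumv (W : forall i, {vspace F i}) : {vspace D} :=
  (\sum_i (dinj i @: W i))%VS.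

Lemma mem_dsumv (W : forall i, {vspace F i}) f :
  reflect (forall i, f i \in W i) (f \in dsumv W).
Proof.
apply: (iffP idP) => [/memv_sumP[h hW ->] i|fW].
  rewrite -dprojE linear_sum; apply: rpred_sum => j _ /=.
  have /memv_imgP[a aW ->] := hW j isT; rewrite dprojE.
  by have [<-|ji] := eqVneq j i; rewrite ?dinj_in // dinj_out // mem0v.
rewrite [f]dsum_dinj /dsumv; apply: memv_sumr => i _; exact: (memv_img (dinj i) (fW i)).
Qed.

End DirectSum.

Record sgraph := SGraph {
  vertex : finType;
  edge_set : {set {set vertex}};
  edge_card : forall e, e \in edge_set -> #|e| = 2
}.

Definition edge (G : sgraph) : finType :=
  {e : {set vertex G} | e \in edge_set G}.

Definition incident (G : sgraph) (v : vertex G) (e : edge G) : bool :=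
  v \in val e.

Definition adjacent (G : sgraph) : rel (vertex G) :=
  [rel u v | [set u; v] \in edge_set G].

Definition connected_graph (G : sgraph) : Prop :=
  forall u v, connect (@adjacent G) u v.

Record orientation (G : sgraph) := Orientation {
  tail : edge G -> vertex G;
  head : edge G -> vertex G;
  orientationP : forall e, val e = [set tail e; head e]
}.

Lemma tail_incident (G : sgraph) (o : orientation G) e : incident (tail o e) e.
Proof. by rewrite /incident (orientationP o) set21. Qed.

Lemma head_incident (G : sgraph) (o : orientation G) e : incident (head o e) e.
Proof. by rewrite /incident (orientationP o) set22. Qed.

Record stalks (R : realType) (G : sgraph) := Stalks {
  vstalk : vertex G -> innerType R;
  estalk : edge G -> innerType R
}.

Section Sheaves.
Variables (R : realType) (G : sgraph) (X : stalks R G).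

(* A discourse sheaf is [X] together with an element of [restrictions]. *)
Definition restrictions : Type :=
  forall v e, incident v e -> 'Hom(vstalk X v, estalk X e).

Definition cochain0 : innerType R := dsum (vstalk X).
Definition cochain1 : innerType R := dsum (estalk X).

Definition coboundary_fun (o : orientation G) (r : restrictions)
    (x : dsum (vstalk X)) : dsum (estalk X) :=
  [ffun e => r (head o e) e (head_incident o e) (x (head o e))
           - r (tail o e) e (tail_incident o e) (x (tail o e))].

Fact coboundary_fun_linear o r : linear (coboundary_fun o r).
Proof.
move=> a x y; apply/ffunP => e; rewrite dsumDE dsumZE !ffunE.
by rewrite !linearP /= scalerBr addrACA scalerN.
Qed.

HB.instance Definition _ o r := GRing.isLinear.Build R _ _ _
  (coboundary_fun o r) (coboundary_fun_linear o r).

Definition coboundary (o : orientation G) (r : restrictions) :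
  'Hom(cochain0, cochain1) := linfun (coboundary_fun o r).

Lemma coboundaryE o r x : coboundary o r x = coboundary_fun o r x.
Proof. by rewrite lfunE. Qed.

Definition block (p : vertex G * edge G) (f : 'Hom(cochain0, cochain1)) :
    'Hom(vstalk X p.1, estalk X p.2) :=
  (dproj (estalk X) p.2 \o f \o dinj (vstalk X) p.1)%VF.

Fact block_linear p : linear (block p).
Proof.
move=> a f g; rewrite /block comp_lfunDr comp_lfunDl.
by rewrite -comp_lfunZr -comp_lfunZl.
Qed.

HB.instance Definition _ p :=
  GRing.isLinear.Build R _ _ _ (block p) (block_linear p).

Definition adapting (I : {set vertex G * edge G}) :
    {vspace 'Hom(cochain0, cochain1)} :=
  (\bigcap_(p | p \notin I) lker (linfun (block p)))%VS.

Lemma mem_adapting (I : {set vertex G * edge G}) f :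
  reflect (forall p, p \notin I -> block p f = 0) (f \in adapting I).
Proof.
apply: (iffP idP) => [|fI].
  rewrite memvE => /subv_bigcapP h p pI; apply/eqP.
  by have := h p pI; rewrite -memvE memv_ker lfunE.
by rewrite memvE; apply/subv_bigcapP => p /fI fp; rewrite -memvE memv_ker lfunE /= fp.
Qed.

End Sheaves.

Section Dynamics.
Local Open Scope classical_set_scope.
Variables (R : realType).

(* Derivative of [f] along [A] at each point of [A], hence one-sided at the
   end points of an interval. *)
Definition has_deriv_on (U : innerType R) (A : set R) (f df : R -> U) : Prop :=
  forall t, A t ->
    inorm ((s - t)^-1 *: (f s - f t) - df t) @[s --> within A t^'] --> (0 : R).

(* The infimum is over the times at which [delta t (x t)] is nonzero; it is
   [+oo] when there is no such time, that is, at an equilibrium. *)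
Definition effective_gap (U W : innerType R) (P : 'End(U)) (T : R)
    (delta : R -> 'Hom(U, W)) (x : R -> U) : \bar R :=
  ereal_inf [set (inorm (P (laplacian (delta t) (x t))) ^+ 2
                  / inorm (delta t (x t)) ^+ 2)%:E
            | t in [set t : R | 0 <= t <= T /\ delta t (x t) != 0]].

End Dynamics.

(* Main.v *)
Require Import Defs.
From HB Require Import structures.
From mathcomp Require Import all_boot all_order all_algebra.
From mathcomp Require Import all_classical all_reals all_analysis.
From mathcomp Require Import ring.
Set Implicit Arguments.
Unset Strict Implicit.
Unset Printing Implicit Defensive.
Import Order.TTheory GRing.Theory Num.Theory.
Import numFieldNormedType.Exports.
Local Open Scope classical_set_scope.
Local Open Scope ring_scope.

(** Write [w = delta x] for the disagreement.  Both equations are projected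
gradient flows of [|w|^2 / 2]: in [x] the gradient is [delta^T w], in [delta] it
is [w x^T].  Since an orthogonal projection [P] satisfies [<v, P v> = |P v|^2],
the energy [E = |w|^2] obeys the exact identity

    E' = - 2 (beta |Pi_M (w x^T)|^2 + alpha |P_Q (delta^T w)|^2)

([energy_deriv]).  Dropping the first term and using the spectral gap in the
second gives [E' <= - 2 alpha lambda E], so [|w|] decays at rate [alpha lambda]
([disagreement_decay]).  As [|delta'| <= beta |w x^T| <= beta B_x |w|], the
restriction maps move at a speed that decays at the same rate, and integrating
it gives the bound ([structural_displacement]).

If [w] vanishes at one time, the same identity bounds [E'] from below: on
[0, T] the map [delta] is bounded, by compactness, so [E' >= - k E].
A Gronwall estimate run backwards in time yields [w 0 = 0]
([equilibrium_start]), and the displacement bound becomes zero.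

All differential arguments are about real functions.  A vector valued curve is
tested against fixed vectors, products are expanded in orthonormal bases, and
integration is replaced by the fact that a function with nonpositive derivative
is nonincreasing. *)

(** * Norm inequalities in finite-dimensional inner product spaces *)

Section InnerProducts.
Variables (R : realType) (U W : innerType R).

Lemma innerNl (V : innerType R) (u v : V) : inner (- u) v = - inner u v.
Proof. by rewrite -scaleN1r innerZl mulN1r. Qed.

Lemma innerNr (V : innerType R) (u v : V) : inner u (- v) = - inner u v.
Proof. by rewrite innerC innerNl innerC. Qed.

Lemma inorm_ge0 (V : innerType R) (u : V) : 0 <= inorm u.
Proof. exact: sqrtr_ge0. Qed.

Lemma sqr_inorm (V : innerType R) (u : V) : inorm u ^+ 2 = inner u u.
Proof. by rewrite sqr_sqrtr // inner_ge0. Qed.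

Lemma inorm0 (V : innerType R) : inorm (0 : V) = 0.
Proof. by rewrite /inorm inner0l sqrtr0. Qed.

Lemma inormZ (V : innerType R) a (u : V) : inorm (a *: u) = `|a| * inorm u.
Proof.
by rewrite /inorm innerZl innerZr mulrA -expr2 sqrtrM ?sqr_ge0 // sqrtr_sqr.
Qed.

(** Cauchy-Schwarz: expand the square of the part of [u] orthogonal to [v],
scaled by [<v, v>] to avoid a division. *)
Lemma inner_sqr_le (V : innerType R) (u v : V) :
  inner u v ^+ 2 <= inner u u * inner v v.
Proof.
have [->|v0] := eqVneq v 0; first by rewrite !inner0r expr0n mulr0.
have vv := inner_gt0 v0.
have := inner_ge0 (inner v v *: u - inner u v *: v).
rewrite innerDl !innerDr !innerNl !innerNr !innerZl !innerZr (innerC v u).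
set a := inner v v in vv *; set b := inner u u; set c := inner u v.
have -> : a * (a * b) - a * (c * c) + (- (c * (a * c)) - - (c * (c * a)))
  = a * (b * a - c ^+ 2) by ring.
by rewrite pmulr_rge0 // subr_ge0.
Qed.

Lemma normr_inner_le (V : innerType R) (u v : V) :
  `|inner u v| <= inorm u * inorm v.
Proof.
rewrite -(@ler_pXn2r _ 2) ?nnegrE ?mulr_ge0 ?inorm_ge0 //.
by rewrite real_normK ?num_real // exprMn !sqr_inorm inner_sqr_le.
Qed.

Lemma inner_le (V : innerType R) (u v : V) : inner u v <= inorm u * inorm v.
Proof. exact: le_trans (ler_norm _) (normr_inner_le u v). Qed.

Lemma inner_onb (V : innerType R) (u v : V) :
  inner u v = \sum_(i < \dim {:V}) inner (onb V)`_i u * inner (onb V)`_i v.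
Proof.
rewrite {1}(onbE v) inner_sumr; apply: eq_bigr => i _.
by rewrite innerZr mulrC (innerC u).
Qed.

(** Why projecting a gradient still dissipates energy: the pairing of the
gradient with its projection is a square. *)
Lemma inner_oproj (V : innerType R) (Q : {vspace V}) u :
  inner u (oproj Q u) = inner (oproj Q u) (oproj Q u).
Proof.
have /mem_orthoc/(_ _ (oproj_mem Q u)) := oproj_orthoc Q u.
by rewrite innerDl innerNl => /eqP; rewrite subr_eq0 => /eqP.
Qed.

Lemma inorm_oproj (V : innerType R) (Q : {vspace V}) u :
  inorm (oproj Q u) <= inorm u.
Proof.
have := inner_le u (oproj Q u); rewrite inner_oproj -sqr_inorm expr2.
have [->|p0] := eqVneq (inorm (oproj Q u)) 0; first by rewrite inorm_ge0.
by rewrite ler_pM2r // lt_def p0 inorm_ge0.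
Qed.

(** The rank-one map [w x^T] represents evaluation at [x] for the Frobenius
product.  This identifies [w x^T] as the gradient of [|delta x|^2 / 2] in
[delta], and it turns statements about values of a linear map into statements
about inner products with it. *)
Lemma inner_outer (f : 'Hom(U, W)) (w : W) (x : U) :
  inner (outer w x) f = inner w (f x).
Proof.
rewrite [RHS]innerC {2}(onbE x) linear_sum inner_suml.
apply: eq_bigr => i _; rewrite lfunE /= innerZl linearZ innerZl.
by rewrite (innerC x) (innerC w).
Qed.

Lemma inorm_outer (w : W) (x : U) : inorm (outer w x) = inorm w * inorm x.
Proof.
rewrite /inorm inner_outer lfunE /= innerZr mulrC sqrtrM //; exact: inner_ge0.
Qed.

(** The operator norm is at most the Frobenius norm: pair [f] with the rank-one
map [(f x) x^T]. *)
Lemma inorm_lfun_le (f : 'Hom(U, W)) x : inorm (f x) <= inorm f * inorm x.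
Proof.
have := inner_le (outer (f x) x) f.
rewrite inner_outer inorm_outer -sqr_inorm expr2 mulrAC -!mulrA.
have [->|p0] := eqVneq (inorm (f x)) 0; first by rewrite mulr_ge0 ?inorm_ge0.
by rewrite ler_pM2l 1?mulrC // lt_def p0 inorm_ge0.
Qed.

Lemma inorm_adjoint_le (f : 'Hom(U, W)) w :
  inorm (adjoint f w) <= inorm f * inorm w.
Proof.
have := inner_le (f (adjoint f w)) w; rewrite adjointP -sqr_inorm expr2.
have [->|p0] := eqVneq (inorm (adjoint f w)) 0.
  by rewrite mulr_ge0 ?inorm_ge0.
move=> h; have {}p0 : 0 < inorm (adjoint f w) by rewrite lt_def p0 inorm_ge0.
rewrite -(ler_pM2l p0); apply: le_trans h _.
by rewrite mulrCA mulrA ler_wpM2r ?inorm_ge0 // inorm_lfun_le.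
Qed.

End InnerProducts.

(** * Differential inequalities for real functions on a segment *)

Section ScalarDerivatives.
Variables (R : realType) (a b : R).
Implicit Types (g h dg dh : R -> R).

(** Differentiability is asked for only in the interior: together with
continuity up to the end points this is what the mean value theorem consumes. *)
Definition deriv_on g dg :=
  {within `[a, b], continuous g} /\
  (forall t, a < t < b -> is_derive t 1 g (dg t)).

Lemma deriv_on_eq g dg dg' : (forall t, a < t < b -> dg t = dg' t) ->
  deriv_on g dg -> deriv_on g dg'.
Proof. by move=> e [cg Dg]; split=> // t tab; rewrite -e //; exact: Dg. Qed.

Lemma deriv_on_cst k : deriv_on (fun=> k) (fun=> 0).
Proof. by split=> [|t _]; [move=> ?; exact: cvg_cst|exact: is_derive_cst]. Qed.

Lemma deriv_onD g h dg dh : deriv_on g dg -> deriv_on h dh ->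
  deriv_on (fun t => g t + h t) (fun t => dg t + dh t).
Proof.
move=> [cg Dg] [ch Dh]; split.
  by move=> x; apply: cvgD; [exact: cg|exact: ch].
by move=> t tab; apply: is_deriveD; [exact: Dg|exact: Dh].
Qed.

Lemma deriv_onM g h dg dh : deriv_on g dg -> deriv_on h dh ->
  deriv_on (fun t => g t * h t) (fun t => dg t * h t + g t * dh t).
Proof.
move=> [cg Dg] [ch Dh]; split.
  by move=> x; apply: cvgM; [exact: cg|exact: ch].
move=> t tab; have := is_deriveM (Dg t tab) (Dh t tab).
by rewrite /GRing.scale /= addrC (mulrC (h t)).
Qed.

Lemma deriv_on_sum (I : Type) (r : seq I) (g dg : I -> R -> R) :
  (forall i, deriv_on (g i) (dg i)) ->
  deriv_on (fun t => \sum_(i <- r) g i t) (fun t => \sum_(i <- r) dg i t).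
Proof.
move=> Dg; elim: r => [|i r IH].
  under eq_fun do rewrite big_nil.
  under [dg in deriv_on _ dg]eq_fun do rewrite big_nil.
  exact: deriv_on_cst.
under eq_fun do rewrite big_cons.
under [dg in deriv_on _ dg]eq_fun do rewrite big_cons.
exact: deriv_onD.
Qed.

Lemma deriv_on_expR k :
  deriv_on (fun t => expR (k * t)) (fun t => k * expR (k * t)).
Proof.
have D (t : R) : is_derive t 1 (fun t : R => expR (k * t)) (k * expR (k * t)).
  have Dk : is_derive t 1 (fun t : R => k * t) k.
    by have := is_deriveZ k (is_derive_id t 1); rewrite /GRing.scale /= mulr1.
  have := @is_derive1_comp _ expR (fun t => k * t) t _ _ (is_derive_expR _) Dk.
  by rewrite mulrC.
split=> // ; apply: continuous_subspaceT => t.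
by apply: differentiable_continuous; apply/derivable1_diffP; case: (D t).
Qed.

Lemma deriv_on_le0 g dg : deriv_on g dg ->
  (forall t, a < t < b -> dg t <= 0) ->
  forall s t, a <= s -> s <= t -> t <= b -> g t <= g s.
Proof.
move=> [cg Dg] dg0 s t le_as st tb.
have DD x : x \in `]a, b[%R -> derivable g x 1 /\ derive1 g x = dg x.
  rewrite in_itv /= => /Dg D; split; first by case: D.
  by rewrite derive1E derive_val.
apply: (ler0_derive1_le_cc _ _ cg) => // [x /DD[]//|x xab||].
- by have [_ ->] := DD _ xab; apply: dg0; move: xab; rewrite in_itv.
- by rewrite in_itv /= tb (le_trans le_as).
- by rewrite in_itv /= le_as (le_trans st).
Qed.

(** The integrating factor [expR (- k t)] makes [g] times it nonincreasing. *)
Lemma gronwall g dg k : deriv_on g dg ->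
  (forall t, a < t < b -> dg t <= k * g t) ->
  forall s t, a <= s -> s <= t -> t <= b -> g t <= g s * expR (k * (t - s)).
Proof.
move=> Dg le_dg s t le_as st tb.
have Dh := deriv_onM Dg (deriv_on_expR (- k)).
have h0 x : a < x < b ->
    dg x * expR (- k * x) + g x * (- k * expR (- k * x)) <= 0.
  move=> /le_dg; rewrite -subr_ge0 => dx.
  have := mulr_ge0 dx (expR_ge0 (- k * x)).
  by rewrite -oppr_le0; congr (_ <= _); ring.
have /= := deriv_on_le0 Dh h0 le_as st tb.
have -> : k * (t - s) = k * t + - k * s by ring.
have e1 : expR (- k * t) * expR (k * t) = 1.
  by rewrite -expRD mulNr addNr expR0.
rewrite expRD (mulrC (expR (k * t))) mulrA -[X in _ -> X <= _]mulr1 -e1 mulrA.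
by rewrite ler_pM2r // expR_gt0.
Qed.

(** A quantity that cannot decrease faster than exponentially was small if it
is small later; this propagates equilibrium back to the initial time. *)
Lemma gronwall_backward g dg k : deriv_on g dg ->
  (forall t, a < t < b -> - (k * g t) <= dg t) ->
  forall s t, a <= s -> s <= t -> t <= b -> g s <= g t * expR (k * (t - s)).
Proof.
move=> Dg le_dg s t le_as st tb.
have DN := deriv_onM (deriv_on_cst (-1)) Dg.
have h0 x : a < x < b -> 0 * g x + -1 * dg x <= - k * (-1 * g x).
  by move=> /le_dg; rewrite mul0r add0r !mulN1r mulrNN lerNl.
have /= := gronwall DN h0 le_as st tb.
rewrite !mulN1r mulNr lerN2 mulNr expRN => gs.
by rewrite -ler_pdivrMr // expR_gt0.
Qed.

End ScalarDerivatives.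

(** * Derivatives of curves in inner product spaces *)

Section VectorDerivatives.
Variables (R : realType) (a b : R).

(** In finite dimension, differentiating after pairing with every fixed vector
loses nothing and leaves only real functions to handle. *)
Definition weak_deriv_on (V : innerType R) (f df : R -> V) :=
  forall c, deriv_on a b (fun t => inner c (f t)) (fun t => inner c (df t)).

Lemma has_deriv_on_weak (V : innerType R) (f df : R -> V) :
  has_deriv_on `[a, b] f df -> weak_deriv_on f df.
Proof.
move=> Df c.
have Q t : t \in `[a, b]%R ->
    (s - t)^-1 * (inner c (f s) - inner c (f t)) @[s --> within [set` `[a, b]%R] t^']
      --> inner c (df t).
  move=> /Df D; apply/cvgrPdist_le => e e0.
  have c1 : 0 < inorm c + 1 by rewrite ltr_wpDl ?inorm_ge0.
  move/cvgrPdist_le/(_ (e / (inorm c + 1)) (divr_gt0 e0 c1)) : D.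
  apply: filterS => s; rewrite sub0r normrN ger0_norm ?inorm_ge0 // => le_s.
  have -> : inner c (df t) - (s - t)^-1 * (inner c (f s) - inner c (f t))
      = - inner c ((s - t)^-1 *: (f s - f t) - df t).
    by rewrite !innerDr innerZr !innerDr !innerNr opprB.
  rewrite normrN; apply: le_trans (normr_inner_le _ _) _.
  apply: le_trans (ler_wpM2l (inorm_ge0 _) le_s) _.
  by rewrite mulrA ler_pdivrMr // mulrDr mulr1 (mulrC e) lerDl ltW.
split.
  (* [g s - g t] is [s - t] times the difference quotient *)
  apply/subspace_continuousP => t tab; apply/cvgrPdist_le => e e0.
  have idt : s - t @[s --> within [set` `[a, b]%R] t^'] --> 0.
    have : s - t @[s --> t] --> (t - t) by apply: cvgB; [exact: cvg_id|exact: cvg_cst].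
    rewrite subrr; apply: cvg_trans; apply: cvg_app.
    apply: cvg_trans (cvg_within _) _; exact: cvg_within.
  have : (s - t) * ((s - t)^-1 * (inner c (f s) - inner c (f t)))
      @[s --> within [set` `[a, b]%R] t^'] --> 0.
    by rewrite -(mul0r (inner c (df t))); apply: cvgM idt (Q t tab).
  move=> /cvgrPdist_le/(_ e e0).
  rewrite !near_withinE; apply: filterS => s h sab.
  have [->|st] := eqVneq s t; first by rewrite subrr normr0 ltW.
  have := h st sab; rewrite mulrA mulfV ?subr_eq0 // mul1r sub0r normrN.
  by rewrite distrC.
move=> t tab.
have tI : t \in `[a, b]%R by rewrite in_itv /=; case/andP: tab => /ltW -> /ltW ->.
have C : h^-1 *: (inner c (f (h *: (1 : R) + t)) - inner c (f t)) @[h --> 0^']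
    --> inner c (df t).
  apply/cvgrPdist_le => e e0.
  have := Q t tI => /cvgrPdist_le/(_ e e0); rewrite !near_withinE => H.
  have I : \forall s \near t, s \in `[a, b]%R.
    have : \forall s \near t, s \in `]a, b[ by apply: near_in_itvoo; rewrite in_itv.
    by apply: filterS => s; rewrite /= !in_itv /= => /andP[/ltW -> /ltW ->].
  have {I}H : \forall s \near t, s != t ->
    `|inner c (df t) - (s - t)^-1 * (inner c (f s) - inner c (f t))| <= e.
    by near=> s => st; apply: (near H) => //; near: s.
  move/nbhs0P: H; rewrite /dnbhs; apply: filterS => h H h0.
  have := H; rewrite [t + h]addrC addrK -subr_eq0 addrK => /(_ h0).
  by rewrite /GRing.scale /= mulr1.
split; first by apply/cvg_ex; exists (inner c (df t)).
exact: cvg_lim C.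
Unshelve. all: by end_near.
Qed.

Lemma weak_deriv_on_shift (V : innerType R) (u : V) (f df : R -> V) :
  weak_deriv_on f df -> weak_deriv_on (fun t => u + f t) df.
Proof.
move=> Df c; under eq_fun do rewrite innerDr.
apply: deriv_on_eq (deriv_onD (deriv_on_cst a b (inner c u)) (Df c)) => t _.
by rewrite add0r.
Qed.

Lemma deriv_on_inner (V : innerType R) (f g df dg : R -> V) :
  weak_deriv_on f df -> weak_deriv_on g dg ->
  deriv_on a b (fun t => inner (f t) (g t))
    (fun t => inner (df t) (g t) + inner (f t) (dg t)).
Proof.
move=> Df Dg; under eq_fun do rewrite inner_onb.
apply: deriv_on_eq (deriv_on_sum _ (fun i => deriv_onM (Df _) (Dg _))) => t _.
by rewrite big_split /= -!inner_onb.
Qed.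

(** Leibniz rule for [d t (x t)]: by [inner_outer] the coordinates of the value
are sums of products of coordinates of [d] and of [x]. *)
Lemma weak_deriv_on_app (U W : innerType R) (d d' : R -> 'Hom(U, W))
    (x x' : R -> U) :
  weak_deriv_on d d' -> weak_deriv_on x x' ->
  weak_deriv_on (fun t => d t (x t)) (fun t => d' t (x t) + d t (x' t)).
Proof.
move=> Dd Dx c.
have appE (h : 'Hom(U, W)) z : inner c (h z) =
    \sum_(i < \dim {:U}) inner (outer c (onb U)`_i) h * inner (onb U)`_i z.
  rewrite {1}(onbE z) linear_sum inner_sumr; apply: eq_bigr => i _.
  by rewrite linearZ innerZr inner_outer mulrC.
under eq_fun do rewrite appE.
apply: deriv_on_eq (deriv_on_sum _ (fun i => deriv_onM (Dd _) (Dx _))) => t _.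
by rewrite big_split /= -!appE innerDr.
Qed.

(** Integrating an exponentially decaying speed.  With [v] the displacement,
[<v, f t> + |v| (K / k) expR (- k t)] has nonpositive derivative, by
Cauchy-Schwarz; comparing its end values and dividing by [|v|] gives the
bound. *)
Lemma displacement_le (V : innerType R) (f df : R -> V) (K k : R) :
  a <= b -> 0 <= K -> 0 < k -> weak_deriv_on f df ->
  (forall t, a < t < b -> inorm (df t) <= K * expR (- k * t)) ->
  inorm (f b - f a) <= K / k * (expR (- k * a) - expR (- k * b)).
Proof.
move=> ab K0 k0 Df le_df; set v := f b - f a.
have Dphi := deriv_onD (Df v)
  (deriv_onM (deriv_on_cst a b (inorm v * (K / k))) (deriv_on_expR a b (- k))).
have phi_le0 t : a < t < b ->
    inner v (df t) + (0 * expR (- k * t)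
      + inorm v * (K / k) * (- k * expR (- k * t))) <= 0.
  move=> tab; rewrite mul0r add0r.
  have -> : inorm v * (K / k) * (- k * expR (- k * t))
      = - (inorm v * (K * expR (- k * t))).
    by field; rewrite gt_eqF.
  rewrite subr_le0; apply: le_trans (inner_le _ _) _.
  by rewrite ler_wpM2l ?inorm_ge0 ?le_df.
have /= := deriv_on_le0 Dphi phi_le0 (lexx a) ab (lexx b).
have [v0|v0] := eqVneq (inorm v) 0.
  move=> _; rewrite v0; apply: mulr_ge0; first by rewrite divr_ge0 // ltW.
  by rewrite subr_ge0 ler_expR !mulNr lerN2 ler_pM2l.
rewrite -lerBrDr -addrA -lerBlDl -innerNr -innerDr -/v -sqr_inorm expr2.
rewrite -mulrBr -(mulrA (inorm v)) ler_pM2l //.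
by rewrite lt_def v0 inorm_ge0.
Qed.

End VectorDerivatives.

(** * Energy dissipation along the joint dynamics *)

Section JointDynamics.
Variables (R : realType) (U W : innerType R).
Variables (Q : {vspace U}) (M : {vspace 'Hom(U, W)}).
Variables (alpha beta T B : R) (d : R -> 'Hom(U, W)) (x : R -> U).
Hypotheses (alpha_gt0 : 0 < alpha) (beta_gt0 : 0 < beta) (T_ge0 : 0 <= T).
Hypothesis x_deriv : weak_deriv_on 0 T x
  (fun t => - alpha *: oproj Q (laplacian (d t) (x t))).
Hypothesis d_deriv : weak_deriv_on 0 T d
  (fun t => - beta *: oproj M (outer (d t (x t)) (x t))).
Hypothesis x_le : forall t, 0 <= t <= T -> inorm (x t) <= B.

Local Notation w t := (d t (x t)).
Local Notation gradx t := (oproj Q (laplacian (d t) (x t))).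
Local Notation gradd t := (oproj M (outer (d t (x t)) (x t))).

(** Both terms of [w' = d' x + d x'] pair with [w] as gradient against projected
gradient, so each contributes minus a square. *)
Lemma energy_deriv : deriv_on 0 T (fun t => inner (w t) (w t))
  (fun t => - (2 * (beta * inorm (gradd t) ^+ 2
                  + alpha * inorm (gradx t) ^+ 2))).
Proof.
have Dw := weak_deriv_on_app d_deriv x_deriv.
apply: deriv_on_eq (deriv_on_inner Dw Dw) => t _.
rewrite (innerC _ (w t)) innerDr scale_lfunE linearZ !innerZr.
rewrite -[X in - beta * X]inner_outer inner_oproj.
have -> : inner (w t) (d t (gradx t)) = inner (gradx t) (gradx t).
  by rewrite innerC adjointP innerC -inner_oproj /laplacian comp_lfunE.
by rewrite !sqr_inorm; ring.
Qed.

Lemma gradd_le t : 0 <= t <= T -> inorm (gradd t) <= B * inorm (w t).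
Proof.
move=> tT; apply: le_trans (inorm_oproj _ _) _.
by rewrite inorm_outer mulrC ler_wpM2r ?inorm_ge0 ?x_le.
Qed.

(** The dissipation is at most a constant multiple of the energy, because [x] is
bounded by hypothesis and [d] by continuity on a compact interval; hence the
energy cannot reach zero in finite time unless it starts there. *)
Lemma equilibrium_start t0 : 0 <= t0 <= T -> w t0 = 0 -> w 0 = 0.
Proof.
move=> /andP[t00 t0T] wt0.
have [D0 D_ge0 d_le] : exists2 D, 0 <= D &
    forall t, 0 <= t <= T -> inorm (d t) ^+ 2 <= D.
  have [cd _] := deriv_on_inner d_deriv d_deriv.
  have [c _ cmax] := EVT_max T_ge0 cd.
  exists (inner (d c) (d c)); first exact: inner_ge0.
  by move=> t tT; rewrite sqr_inorm; apply: cmax; rewrite in_itv.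
pose k := 2 * (beta * B ^+ 2 + alpha * D0).
have le_dE t : 0 < t < T -> - (k * inner (w t) (w t))
    <= - (2 * (beta * inorm (gradd t) ^+ 2 + alpha * inorm (gradx t) ^+ 2)).
  move=> /andP[t_gt0 tT]; have tI : 0 <= t <= T by rewrite !ltW.
  rewrite lerN2 /k -mulrA ler_pM2l // mulrDl -(mulrA beta) -(mulrA alpha) -!sqr_inorm.
  apply: lerD; rewrite ler_pM2l //.
    rewrite -exprMn ler_pXn2r ?nnegrE ?inorm_ge0 ?gradd_le //.
    by rewrite (le_trans (inorm_ge0 (gradd t))) ?gradd_le.
  apply: le_trans (ler_wpM2r (sqr_ge0 _) (d_le t tI)).
  rewrite -exprMn ler_pXn2r ?nnegrE ?mulr_ge0 ?inorm_ge0 //.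
  apply: le_trans (inorm_oproj _ _) _.
  by rewrite /laplacian comp_lfunE inorm_adjoint_le.
have := gronwall_backward energy_deriv le_dE (lexx 0) t00 t0T.
rewrite wt0 inner0l mul0r => E0; apply: inner_eq0.
by apply/eqP; rewrite eq_le E0 inner_ge0.
Qed.

(* Stated without a quotient, so that it also holds where [w t = 0] and can be
   applied, with any [lambda], to a system always at equilibrium. *)
Variable lambda : R.
Hypothesis lambda_gt0 : 0 < lambda.
Hypothesis gap : forall t, 0 <= t <= T ->
  lambda * inorm (w t) ^+ 2 <= inorm (gradx t) ^+ 2.

Lemma disagreement_decay t : 0 <= t <= T ->
  inorm (w t) <= inorm (w 0) * expR (- (alpha * lambda) * t).
Proof.
move=> /andP[t0 tT].
have le_dE s : 0 < s < T ->
    - (2 * (beta * inorm (gradd s) ^+ 2 + alpha * inorm (gradx s) ^+ 2))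
    <= - (2 * (alpha * lambda)) * inner (w s) (w s).
  move=> /andP[s0 sT]; have sI : 0 <= s <= T by rewrite !ltW.
  rewrite mulNr lerN2 -mulrA ler_pM2l // -sqr_inorm -mulrA ler_wpDl //.
    by rewrite mulr_ge0 ?sqr_ge0 ?ltW.
  by rewrite ler_pM2l ?gap.
have := gronwall energy_deriv le_dE (lexx 0) t0 tT.
have -> : - (2 * (alpha * lambda)) * (t - 0) = - (alpha * lambda) * t *+ 2 by ring.
rewrite -mulr_natl expRM_natl -!sqr_inorm -exprMn.
by rewrite ler_pXn2r // nnegrE ?mulr_ge0 ?inorm_ge0 ?expR_ge0.
Qed.

Lemma structural_displacement :
  inorm (d T - d 0) <= beta * B * inorm (w 0) / (alpha * lambda)
                       * (1 - expR (- (alpha * lambda * T))).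
Proof.
have al0 : 0 < alpha * lambda by rewrite mulr_gt0.
have B0 : 0 <= B by rewrite (le_trans (inorm_ge0 (x 0))) ?x_le ?lexx.
have K0 : 0 <= beta * B * inorm (w 0) by rewrite mulr_ge0 ?inorm_ge0 // mulr_ge0 // ltW.
have := displacement_le T_ge0 K0 al0 d_deriv _.
rewrite mulr0 expR0 mulNr; apply=> t /andP[t0 tT].
have tI : 0 <= t <= T by rewrite !ltW.
rewrite inormZ normrN gtr0_norm // -!mulrA ler_pM2l //.
apply: le_trans (gradd_le tI) _; rewrite ler_wpM2l //.
exact: disagreement_decay.
Qed.

End JointDynamics.

(** * The displacement bound *)

Theorem proposition6p1 (R : realType)
    (G : sgraph) (connG : connected_graph G) (o : orientation G)
    (X : stalks R G)
    (U : {set vertex G}) (S : forall v, {vspace vstalk X v})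
    (S_supp : forall v, v \notin U -> S v = 0%VS)
    (I : {set vertex G * edge G})
    (I_incident : forall v e, (v, e) \in I -> incident v e)
    (alpha beta : R) (alpha_gt0 : 0 < alpha) (beta_gt0 : 0 < beta)
    (T : R) (T_ge0 : 0 <= T)
    (u : cochain0 X) (u_S : u \in dsumv S)
    (y : R -> cochain0 X)
    (y_Q : forall t : R, 0 <= t <= T -> y t \in dsumv (fun v => orthoc (S v)))
    (r : R -> restrictions X)
    (y0 : cochain0 X) (delta0 : 'Hom(cochain0 X, cochain1 X))
    (Bx : R) (Bx_gt0 : 0 < Bx) :
  let Q : {vspace cochain0 X} := dsumv (fun v => orthoc (S v)) in
  let delta (t : R) := coboundary o (r t) in
  let x (t : R) := u + y t in
  let x0 := u + y0 in
  let lambda_eff := effective_gap (oproj Q) T delta x in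
  has_deriv_on `[0, T] y
    (fun t => - alpha *: oproj Q (laplacian (delta t) (x t))) ->
  has_deriv_on `[0, T] delta
    (fun t => - beta *: oproj (adapting X I) (outer (delta t (x t)) (x t))) ->
  y 0 = y0 -> delta 0 = delta0 ->
  (ereal_sup [set (inorm (x t))%:E | t in `[0%R, T]] <= Bx%:E)%E ->
  (0 < lambda_eff)%E ->
  let lambda := fine lambda_eff in
  let bound := beta * Bx * inorm (delta0 x0) / (alpha * lambda) in
  [/\ inorm (delta T - delta0) <= bound * (1 - expR (- (alpha * lambda * T))),
      bound * (1 - expR (- (alpha * lambda * T))) <= bound
    & (exists2 t : R, 0 <= t <= T & delta t (x t) = 0) ->
      inorm (delta T - delta0) = 0].
Proof.
move=> Q delta x x0 gapE Dy Ddelta y_start delta_start x_sup gap_gt0 lambda bound.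
have Dx := weak_deriv_on_shift u (has_deriv_on_weak Dy).
have Dd := has_deriv_on_weak Ddelta.
have x_le t : 0 <= t <= T -> inorm (x t) <= Bx.
  move=> tT; rewrite -lee_fin; apply: le_trans x_sup.
  by apply: ereal_sup_ubound; exists t => //=; rewrite in_itv.
have disp l := @structural_displacement _ _ _ Q (adapting X I) _ _ T Bx delta x
  alpha_gt0 beta_gt0 T_ge0 Dx Dd x_le l.
have start0 := @equilibrium_start _ _ _ Q (adapting X I) _ _ T Bx delta x
  alpha_gt0 beta_gt0 T_ge0 Dx Dd x_le.
have -> : delta0 = delta 0 by [].
have bound_start : delta 0 (x 0) = 0 -> bound = 0.
  move=> w0; have -> : bound = beta * Bx * inorm (delta 0 (x 0)) / (alpha * lambda).
    by rewrite /bound /x0 -y_start -delta_start.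
  by rewrite w0 inorm0 mulr0 mul0r.
have bound_ge0 : 0 <= bound.
  have lambda_ge0 : 0 <= lambda by rewrite fine_ge0 // ltW.
  by apply: divr_ge0; apply: mulr_ge0; rewrite ?inorm_ge0 ?mulr_ge0 // ltW.
have main : inorm (delta T - delta 0)
    <= bound * (1 - expR (- (alpha * lambda * T))).
  (* When the disagreement vanishes throughout, the gap is infinite and [lambda]
     is the default value 0; any positive rate, here 1, then works, as the
     initial disagreement is zero. *)
  have [[t tT wt]|eqm] :=
      pselect (exists2 t, 0 <= t <= T & delta t (x t) != 0); last first.
    have w0 t : 0 <= t <= T -> delta t (x t) = 0.
      by move=> tT; apply/eqP/negP => /negP wt; apply: eqm; exists t.
    have w00 : delta 0 (x 0) = 0 by apply: w0; rewrite lexx.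
    rewrite bound_start // mul0r.
    have := disp 1 ltr01; rewrite w00 inorm0 mulr0 !mul0r; apply => t tT.
    by rewrite w0 // inorm0 expr0n mulr0 sqr_ge0.
  have gap_le s : 0 <= s <= T -> delta s (x s) != 0 ->
      (gapE <= (inorm (oproj Q (laplacian (delta s) (x s))) ^+ 2
                / inorm (delta s (x s)) ^+ 2)%:E)%E.
    by move=> sT ws; apply: ereal_inf_lbound; exists s.
  have gap_fin : gapE \is a fin_num.
    by rewrite gt0_fin_numE // (le_lt_trans (gap_le t tT wt)) ?ltry.
  have gapK : gapE = lambda%:E by rewrite fineK.
  have lambda_gt0 : 0 < lambda by rewrite -lte_fin -gapK.
  have := disp lambda lambda_gt0.
  have -> : inorm (delta 0 (x 0)) = inorm (delta0 x0).
    by rewrite /x0 -y_start -delta_start.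
  apply=> s sT; have [->|ws] := eqVneq (delta s (x s)) 0.
    by rewrite inorm0 expr0n mulr0 sqr_ge0.
  have := gap_le s sT ws; rewrite gapK lee_fin ler_pdivlMr //.
  by rewrite sqr_inorm inner_gt0.
split=> //; first by rewrite ler_piMr // gerBl expR_ge0.
move=> [t tT wt]; apply/eqP; rewrite eq_le inorm_ge0 andbT.
by move: main; rewrite (bound_start (start0 t tT wt)) mul0r.
Qed.
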